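(* Let $n\ge1$. Two polytopes $\mathcal{P}_1,\mathcal{P}_2\in\mathcal{C}_n$ are unimodularly equivalent if and only if their corresponding rooted $3$-cacti $G_1$ and $G_2$ are isomorphic (as rooted graphs).
   Context: Unimodular equivalence means equivalence under integral translations and $GL(n,\mathbb{Z})$. For an integral polytope $\mathcal{P}\subset\mathbb{R}^k$ and lattice points $s_1,s_2\in\mathcal{P}$, the pseudo-bipyramid is $\operatorname{Pbipyr}(\mathcal{P},s_1,s_2)=\operatorname{conv}(\{(s_1,1),(s_2,-1)\}\cup\{(x,0):x\in\mathcal{P}\})\subset\mathbb{R}^{k+1}$. The class $\mathcal{C}_n$ (up to unimodular equivalence): $\mathcal{C}_1=\{[-1,1]\}$, and $\mathcal{C}_{k+1}$ consists of the polytopes $\operatorname{Pbipyr}(\mathcal{P},0,y)$ with $\mathcal{P}\in\mathcal{C}_k$ and $y\in\mathcal{P}\cap\mathbb{Z}^k$. Thus a polytope in $\mathcal{C}_n$ is given by a sequence $\mathcal{P}^{(1)}=[-1,1]$, $\mathcal{P}^{(k+1)}=\operatorname{Pbipyr}(\mathcal{P}^{(k)},0,y_k)$ with $y_k\in\mathcal{P}^{(k)}\cap\mathbb{Z}^k$. The lattice points of $\mathcal{P}^{(n)}$ are the origin (its unique interior lattice point) and its $2n$ vertices. A $3$-cactus is a connected graph in which every edge belongs to exactly one simple cycle and every such cycle is a triangle. The rooted $3$-cactus $G$ corresponding to $\mathcal{P}=\mathcal{P}^{(n)}\in\mathcal{C}_n$ has vertices in bijection with the lattice points of $\mathcal{P}$,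 the root being the origin, and is built along the construction: for $k=1$ it is a single triangle with vertices $0$ (root), $1$, $-1$; passing from $\mathcal{P}^{(k)}$ to $\mathcal{P}^{(k+1)}$, identify each lattice point $x$ of $\mathcal{P}^{(k)}$ with $(x,0)$ and attach a new triangle at the vertex corresponding to $y:=(y_k,0)$, whose two new vertices correspond to the new lattice points $e_{k+1}$ and $y-e_{k+1}$. Isomorphism of rooted $3$-cacti means root-preserving graph isomorphism. *)

(* Defs.v *)
From HB Require Import structures.
From mathcomp Require Import all_boot all_order all_algebra.
From mathcomp Require Import all_classical reals.

Set Implicit Arguments.
Unset Strict Implicit.
Unset Printing Implicit Defensive.

Import Order.TTheory GRing.Theory Num.Theory.
Local Open Scope classical_set_scope.
Local Open Scope ring_scope.

(* Points of R^n and of Z^n are row vectors; [snoc x a] is (x, a). *)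
Definition snoc (T : Type) (k : nat) (x : 'rV[T]_k) (a : T) : 'rV[T]_k.+1 :=
  \row_j (if unlift ord_max j is Some i then x ord0 i else a).

Definition to_real (R : realType) (k : nat) (x : 'rV[int]_k) : 'rV[R]_k :=
  map_mx intr x.

Definition conv (R : realType) (k : nat) (A : set 'rV[R]_k) : set 'rV[R]_k :=
  [set x | exists (m : nat) (w : 'I_m -> R) (p : 'I_m -> 'rV[R]_k),
    [/\ forall i, 0 <= w i, \sum_i w i = 1, forall i, A (p i)
      & x = \sum_i w i *: p i]].

Definition unimod_equiv (R : realType) (n : nat) (P Q : set 'rV[R]_n) : Prop :=
  exists (U : 'M[int]_n) (t : 'rV[int]_n),
    U \in unitmx /\
    Q = [set x *m map_mx intr U + to_real R t | x in P].

Definition Pbipyr (R : realType) (k : nat) (P : set 'rV[R]_k)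
    (s1 s2 : 'rV[int]_k) : set 'rV[R]_k.+1 :=
  conv ([set snoc (to_real R s1) 1; snoc (to_real R s2) (-1)]
        `|` [set snoc x 0 | x in P]).

Definition lattice_points (R : realType) (k : nat) (P : set 'rV[R]_k) :
    set 'rV[int]_k := [set x | P (to_real R x)].

Record rooted_graph (T : Type) := RootedGraph {
  gverts : set T;
  gadj : T -> T -> Prop;
  groot : T }.

Definition rooted_iso (S T : Type) (G : rooted_graph S) (H : rooted_graph T) :
    Prop :=
  exists f : S -> T,
    [/\ set_bij (gverts G) (gverts H) f,
        f (groot G) = groot H
      & forall u v, gverts G u -> gverts G v ->
          (gadj G u v <-> gadj H (f u) (f v))].

Definition triangle_adj (T : Type) (a b c u v : T) : Prop :=
  [/\ u <> v, [set a; b; c] u & [set a; b; c] v].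

Definition cactus1 : rooted_graph 'rV[int]_1 :=
  {| gverts := [set 0; const_mx 1; const_mx (-1)];
     gadj := triangle_adj 0 (const_mx 1) (const_mx (-1));
     groot := 0 |}.

(* [snoc 0 1] is e_{k+1}. *)
Definition attach_triangle (k : nat) (G : rooted_graph 'rV[int]_k)
    (y : 'rV[int]_k) : rooted_graph 'rV[int]_k.+1 :=
  let e : 'rV[int]_k.+1 := snoc 0 1 in
  let y0 : 'rV[int]_k.+1 := snoc y 0 in
  {| gverts := [set snoc x 0 | x in gverts G] `|` [set e; y0 - e];
     gadj := fun u v =>
       (exists x x', [/\ gadj G x x', u = snoc x 0 & v = snoc x' 0])
       \/ triangle_adj y0 e (y0 - e) u v;
     groot := snoc (groot G) 0 |}.

(* [construction P G]: P is some P^(n), built through a choice of lattice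
   points y_1, ..., y_(n-1), and G is the rooted 3-cactus built through the
   same choice.  The vertices of G are the lattice points of P themselves: it
   follows that [gverts G = lattice_points P] and [groot G = 0]. *)
Inductive construction (R : realType) :
    forall n : nat, set 'rV[R]_n -> rooted_graph 'rV[int]_n -> Prop :=
| construction1 :
    construction [set x : 'rV[R]_1 | -1 <= x ord0 ord0 <= 1] cactus1
| constructionS k (P : set 'rV[R]_k) (G : rooted_graph 'rV[int]_k)
    (y : 'rV[int]_k) :
    construction P G -> lattice_points P y ->
    construction (Pbipyr P 0 y) (attach_triangle G y).

(* Membership in C_n is up to unimodular equivalence only here, at the end:
   the steps of a construction need the interior lattice point of P^(k) to be
   the origin, and a translation would move it. *)
Definition in_C_with_cactus (R : realType) (n : nat) (P : set 'rV[R]_n)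
    (G : rooted_graph 'rV[int]_n) : Prop :=
  exists2 P0 : set 'rV[R]_n, construction P0 G & unimod_equiv P0 P.

(* Main.v *)
(* Both directions rest on reading the triangles off the lattice points: in a
   polytope of the class, the relations a = b + c between lattice points with
   b, c <> 0 are exactly the triangles with apex a, as one sees by comparing
   last coordinates, and the origin is the only lattice point that is the
   midpoint of two other ones.  An affine unimodular map of polytopes therefore
   fixes the origin and preserves triangles.  Conversely an isomorphism of
   rooted cacti maps 3-cliques, that is triangles, to triangles; since every
   nonzero lattice point lies below the apex of exactly one triangle, apexes go
   to apexes, so the isomorphism respects all the relations a = b + c and is
   the restriction of a linear map, unimodular because the basis vectors are
   among the vertices.  The polytope is the hull of its lattice points. *)

Require Import Defs.
From mathcomp Require Import all_boot all_order all_algebra.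
From mathcomp Require Import all_classical reals.
From mathcomp Require Import ring lra zify.

Set Implicit Arguments.
Unset Strict Implicit.
Unset Printing Implicit Defensive.

Import Order.TTheory GRing.Theory Num.Theory.
Local Open Scope classical_set_scope.
Local Open Scope ring_scope.

(** * Row vectors and convex hulls *)

Lemma snoc_lift (T : Type) k (x : 'rV[T]_k) a j :
  snoc x a ord0 (lift ord_max j) = x ord0 j.
Proof. by rewrite mxE liftK. Qed.

Lemma snoc_max (T : Type) k (x : 'rV[T]_k) a : snoc x a ord0 ord_max = a.
Proof. by rewrite mxE unlift_none. Qed.

Lemma snocP (T : Type) k (z : 'rV[T]_k.+1) : exists x a, z = snoc x a.
Proof.
exists (\row_j z ord0 (lift ord_max j)), (z ord0 ord_max).
apply/rowP => j; rewrite mxE.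
by case: unliftP => [i|] ->; rewrite ?mxE.
Qed.

Lemma snoc_inj (T : Type) k (x x' : 'rV[T]_k) a a' :
  snoc x a = snoc x' a' <-> x = x' /\ a = a'.
Proof.
split=> [E|[-> ->] //]; split; last by rewrite -(snoc_max x a) E snoc_max.
by apply/rowP => j; rewrite -(snoc_lift x a) E snoc_lift.
Qed.

Lemma snoc0 (V : nmodType) k : snoc (0 : 'rV[V]_k) 0 = 0.
Proof. by apply/rowP => j; rewrite !mxE; case: unlift => // i; rewrite mxE. Qed.

Lemma snocD (V : nmodType) k (x y : 'rV[V]_k) a b :
  snoc x a + snoc y b = snoc (x + y) (a + b).
Proof. by apply/rowP => j; rewrite !mxE; case: unlift => // i; rewrite mxE. Qed.

Lemma snocN (V : zmodType) k (x : 'rV[V]_k) a : - snoc x a = snoc (- x) (- a).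
Proof. by apply/rowP => j; rewrite !mxE; case: unlift => // i; rewrite mxE. Qed.

Lemma snocZ (K : pzRingType) k (x : 'rV[K]_k) a c :
  c *: snoc x a = snoc (c *: x) (c * a).
Proof. by apply/rowP => j; rewrite !mxE; case: unlift => // i; rewrite mxE. Qed.

Lemma to_real_snoc (R : realType) k (x : 'rV[int]_k) a :
  to_real R (snoc x a) = snoc (to_real R x) a%:~R.
Proof. by apply/rowP => j; rewrite !mxE; case: unlift => // i; rewrite mxE. Qed.

Lemma to_real0 (R : realType) k : to_real R (0 : 'rV[int]_k) = 0.
Proof. exact: map_mx0. Qed.

Lemma to_real_inj (R : realType) k : injective (@to_real R k).
Proof.
move=> x y /rowP E; apply/rowP => j; apply: (@intr_inj R).
by have := E j; rewrite !mxE.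
Qed.

(** The matrix is [U] with the row [r] appended at the bottom: a linear map is extended by choosing
    the image [r] of the last basis vector. *)
Lemma snoc_mulmx (K : pzSemiRingType) k m (x : 'rV[K]_k) (a : K)
    (U : 'M[K]_(k, m)) (r : 'rV[K]_m) :
  snoc x a *m (\matrix_(i, j)
     (if unlift ord_max i is Some l then U l j else r ord0 j))
  = x *m U + a *: r.
Proof.
apply/rowP => j; rewrite !mxE (bigD1_ord ord_max) //= snoc_max mxE unlift_none.
rewrite addrC; congr (_ + _); apply: eq_bigr => i _.
by rewrite snoc_lift mxE liftK.
Qed.

Section Convexity.
Variables (R : realType) (k : nat).
Implicit Types (A B : set 'rV[R]_k).

Definition convex B := forall (t : R) x y, 0 <= t <= 1 -> B x -> B y ->
  B (t *: x + (1 - t) *: y).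

Lemma convexE B (a b : R) x y : convex B -> 0 <= a -> 0 <= b -> a + b = 1 ->
  B x -> B y -> B (a *: x + b *: y).
Proof.
move=> cB a0 b0 ab Bx By; rewrite (_ : b = 1 - a); last by lra.
by apply: cB => //; lra.
Qed.

Lemma sub_conv A : A `<=` conv A.
Proof.
move=> x Ax; exists 1, (fun=> 1), (fun=> x); split => //.
- by rewrite big_ord1.
- by rewrite big_ord1 scale1r.
Qed.

Lemma convex_conv A : convex (conv A).
Proof.
move=> t _ _ /andP[t0 t1] [m [w [p [w0 w1 Ap ->]]]] [m' [w' [p' [w'0 w'1 Ap' ->]]]].
exists (m + m')%N,
  (fun i => match fintype.split i with inl j => t * w j | inr j => (1 - t) * w' j end),
  (fun i => match fintype.split i with inl j => p j | inr j => p' j end).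
have t1' : 0 <= 1 - t by lra.
split.
- by move=> i; case: fintype.split => j; rewrite mulr_ge0.
- rewrite big_split_ord /=.
  under eq_bigr do rewrite (unsplitK (inl _)).
  under [X in _ + X]eq_bigr do rewrite (unsplitK (inr _)).
  by rewrite -!mulr_sumr w1 w'1; lra.
- by move=> i; case: fintype.split.
- rewrite big_split_ord /= !scaler_sumr.
  by congr (_ + _); apply: eq_bigr => i _;
    rewrite ?(unsplitK (inl _)) ?(unsplitK (inr _)) scalerA.
Qed.

Lemma conv_min A B : convex B -> A `<=` B -> conv A `<=` B.
Proof.
move=> cB AB _ [m [w [p [w0 w1 /(_ _)/AB Bp ->]]]].
(* Dividing by the total weight frees the weights from summing to 1, so that the induction can split
   off one point. *)
suff: 0 < \sum_i w i -> B ((\sum_i w i)^-1 *: \sum_i w i *: p i).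
  by rewrite w1 invr1 scale1r; apply; exact: ltr01.
clear w1; elim: m w p w0 Bp => [|m IH] w p w0 Bp; first by rewrite big_ord0 ltxx.
rewrite !big_ord_recl; set s := \sum_(i < m) w _.
have s0 : 0 <= s by apply: sumr_ge0.
have := w0 ord0; set a := w ord0 => a0 as0.
(* If the remaining weights sum to 0, they all vanish, being nonnegative, and the quotient is the
   first point alone. *)
have [sE|sN] := eqVneq s 0.
  rewrite sE addr0 big1; last first.
    move=> i _; move/eqP: sE; rewrite psumr_eq0 // => /allP/(_ i).
    by rewrite mem_index_enum => /(_ isT)/eqP ->; rewrite scale0r.
  rewrite addr0 scalerA mulVf ?scale1r//.
  by move: as0; rewrite sE addr0 => /gt_eqF ->.
have sp : 0 < s by rewrite lt0r sN.
have := IH (fun i => w (lift ord0 i)) (fun i => p (lift ord0 i)) _ _ sp.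
rewrite -/s => /(_ (fun=> w0 _) (fun=> Bp _)) Bs.
rewrite (_ : (a + s)^-1 *: _ = (a / (a + s)) *: p ord0 +
    (s / (a + s)) *: (s^-1 *: \sum_(i < m) w (lift ord0 i) *: p (lift ord0 i))).
  apply: (convexE cB) => //; rewrite ?divr_ge0 ?(ltW as0)//.
  by rewrite -mulrDl divff ?gt_eqF.
rewrite scalerDr !scalerA; congr (_ *: _ + _ *: _); first exact: mulrC.
by field; rewrite sN gt_eqF.
Qed.

Lemma conv_mono A B : A `<=` B -> conv A `<=` conv B.
Proof.
by move=> AB; apply: conv_min (@convex_conv _) _ => x /AB; exact: sub_conv.
Qed.

End Convexity.

Lemma conv_linear (R : realType) k m (M : 'M[R]_(k, m)) (A : set 'rV[R]_k) :
  conv [set x *m M | x in A] = [set x *m M | x in conv A].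
Proof.
apply/seteqP; split.
  apply: conv_min.
    move=> t _ _ t01 [x Ax <-] [y Ay <-].
    exists (t *: x + (1 - t) *: y); first exact: convex_conv.
    by rewrite mulmxDl !scalemxAl.
  by move=> _ [x Ax <-]; exists x => //; exact: sub_conv.
(* The preimage of a convex set under a linear map is convex, so minimality of the hull applies to
   it. *)
suff cA : conv A `<=` [set x | conv [set x *m M | x in A] (x *m M)].
  by move=> _ [x /cA Ax <-].
apply: conv_min.
  move=> t x y t01 Ax Ay /=; rewrite mulmxDl -!scalemxAl.
  exact: convex_conv.
by move=> x Ax; apply: sub_conv; exists x.
Qed.

(** * Pseudo-bipyramids: their lattice points, and their description as hulls *)

Section Bipyramid.
Variables (R : realType) (k : nat) (P : set 'rV[R]_k) (y : 'rV[int]_k).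
Hypotheses (cP : convex P) (P0 : P 0) (Py : lattice_points P y).

(** Since [P] is convex, all the base points of a combination merge into one [p]: one weight for
    each apex and one for the base suffice. *)
Lemma PbipyrP z : Pbipyr P 0 y z -> exists a b c p,
  [/\ 0 <= a /\ 0 <= b, 0 <= c, a + b + c = 1, P p
    & z = snoc (b *: to_real R y + c *: p) (a - b)].
Proof.
pose B := [set z | exists a b c p, [/\ 0 <= a /\ 0 <= b, 0 <= c, a + b + c = 1,
  P p & z = snoc (b *: to_real R y + c *: p) (a - b)]].
apply: (@conv_min _ _ _ B); last first.
  move=> {}z [[|]->|[x Px <-]].
  - exists 1, 0, 0, 0; split; rewrite ?scale0r ?addr0 ?subr0 ?to_real0 //.
  - exists 0, 1, 0, 0; split; rewrite ?scale0r ?scale1r ?addr0 ?sub0r ?add0r //.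
  - exists 0, 0, 1, x; split; rewrite ?scale0r ?scale1r ?addr0 ?subr0 ?add0r //.
move=> t _ _ /andP[t0 t1] [a [b [c [p [[a0 b0] c0 s Pp ->]]]]]
  [a' [b' [c' [p' [[a'0 b'0] c'0 s' Pp' ->]]]]].
have t1' : 0 <= 1 - t by lra.
pose d := t * c + (1 - t) * c'.
have [q Pq dq] : exists2 q, P q & d *: q = (t * c) *: p + ((1 - t) * c') *: p'.
  have tc : 0 <= t * c by rewrite mulr_ge0.
  have tc' : 0 <= (1 - t) * c' by rewrite mulr_ge0.
  (* When the base has total weight 0, any point of [P] can serve as [q]; the origin is taken. *)
  have [d0|dN] := eqVneq d 0.
    exists 0 => //; rewrite scaler0.
    have [-> ->] : t * c = 0 /\ (1 - t) * c' = 0 by rewrite /d in d0; lra.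
    by rewrite !scale0r addr0.
  have dp : 0 < d by rewrite lt0r dN addr_ge0.
  exists ((t * c / d) *: p + ((1 - t) * c' / d) *: p').
    apply: (convexE cP) => //; rewrite ?divr_ge0 ?(ltW dp)//.
    by rewrite -mulrDl divff.
  by rewrite scalerDr !scalerA; congr (_ *: _ + _ *: _); field.
exists (t * a + (1 - t) * a'), (t * b + (1 - t) * b'), d, q; split => //.
- by split; rewrite addr_ge0 ?mulr_ge0.
- by rewrite addr_ge0 ?mulr_ge0.
- rewrite /d; transitivity (t * (a + b + c) + (1 - t) * (a' + b' + c')).
    by ring.
  by rewrite s s'; ring.
- rewrite !snocZ snocD dq; congr snoc; last by ring.
  by rewrite !scalerDr !scalerA scalerDl addrACA.
Qed.

(** The height [a - b] lies between -1 and 1, hence is -1, 0 or 1 at a lattice point. Height 1 or -1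
    leaves only the apex; at height 0 the point falls back into [P] by convexity. *)
Lemma lattice_points_Pbipyr : lattice_points (Pbipyr P 0 y) =
  [set snoc x 0 | x in lattice_points P] `|` [set snoc 0 1; snoc y (-1)].
Proof.
apply/seteqP; split => z /=; last first.
  move=> [[x Px <-]|[|] ->]; rewrite /lattice_points /= to_real_snoc;
    apply: sub_conv.
  - by right; exists (to_real R x).
  - by left; left.
  - by left; right.
case: (snocP z) => x [t ->]; rewrite /lattice_points /= to_real_snoc.
move=> /PbipyrP[a [b [c [p [[a0 b0] c0 s Pp /snoc_inj[xE tE]]]]]].
have t1 : t <= 1 by rewrite -(ler_int R) tE; lra.
have tN1 : -1 <= t by rewrite -(ler_int R) tE; lra.
have : t = -1 \/ t = 0 \/ t = 1 by lia.
case=> [tt|[tt|tt]]; subst t.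
- have [b1 c1] : b = 1 /\ c = 0 by lra.
  right; right; congr snoc; apply: (@to_real_inj R).
  by rewrite xE b1 c1 scale1r scale0r addr0.
- left; exists x => //=; rewrite xE.
  have ba : b = a by lra.
  have [c1|cN] := eqVneq c 1.
    have -> : b = 0 by lra.
    by rewrite c1 scale0r scale1r add0r.
  have b2 : b + b = 1 - c by lra.
  (* Equal apex weights satisfy 2b = 1 - c, so the apexes contribute 1 - c times the midpoint of 0
     and [y], which is in [P]. *)
  rewrite (_ : b *: to_real R y = (1 - c) *: (2^-1 *: to_real R y + 2^-1 *: 0)).
    apply: (convexE cP) => //; [by lra|by lra|].
    by apply: (convexE cP) => //; lra.
  by rewrite scaler0 addr0 scalerA; congr (_ *: _); lra.
- have [b1 c1] : b = 0 /\ c = 0 by lra.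
  right; left; congr snoc; apply: (@to_real_inj R).
  by rewrite xE b1 c1 !scale0r addr0 to_real0.
Qed.

End Bipyramid.

Lemma Pbipyr_conv (R : realType) k (A : set 'rV[int]_k) y :
  Pbipyr (conv [set to_real R x | x in A]) 0 y =
  conv [set to_real R x | x in
    [set snoc x 0 | x in A] `|` [set snoc 0 1; snoc y (-1)]].
Proof.
apply/seteqP; split; last first.
  apply: conv_mono => _ [_ [[x Ax <-]|[|] ->] <-]; rewrite to_real_snoc.
  - by right; exists (to_real R x) => //; apply: sub_conv; exists x.
  - by left; left.
  - by left; right.
set C := conv [set to_real R x | x in _ `|` _].
apply: conv_min (@convex_conv _ _ _) _ => _ [[|]->|[x + <-]].
- apply: sub_conv; exists (snoc 0 1); last exact: to_real_snoc.
  by right; left.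
- apply: sub_conv; exists (snoc y (-1)); last exact: to_real_snoc.
  by right; right.
- apply: (@conv_min _ _ _ [set x | C (snoc x 0)]).
    move=> t u v t01 Cu Cv /=.
    rewrite (_ : snoc _ _ = t *: snoc u 0 + (1 - t) *: snoc v 0).
      exact: convex_conv.
    by rewrite !snocZ snocD !mulr0 addr0.
  move=> _ [v Av <-]; apply: sub_conv; exists (snoc v 0).
    by left; exists v.
  exact: to_real_snoc.
Qed.

(** * Triangles of a cactus *)

(* Starting in dimension 0 makes the first triangle an ordinary step. *)
Inductive cactus : forall n, rooted_graph 'rV[int]_n -> Prop :=
| cactus0 :
    @cactus 0 {| gverts := [set 0]; gadj := fun _ _ => False; groot := 0 |}
| cactusS k (G : rooted_graph 'rV[int]_k) y :
    cactus G -> gverts G y -> cactus (attach_triangle G y).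

(** The vertices of [attach_triangle] with y - e in coordinates, which is also the form of the
    lattice points of [Pbipyr]. *)
Definition extend_verts k (V : set 'rV[int]_k) (y : 'rV[int]_k) :
    set 'rV[int]_k.+1 :=
  [set snoc x 0 | x in V] `|` [set snoc 0 1; snoc y (-1)].

Lemma snocB_e k (y : 'rV[int]_k) : snoc y 0 - snoc 0 1 = snoc y (-1).
Proof. by rewrite snocN snocD oppr0 addr0 add0r. Qed.

Lemma gverts_attach k (G : rooted_graph 'rV[int]_k) y :
  gverts (attach_triangle G y) = extend_verts (gverts G) y.
Proof. by rewrite /= snocB_e. Qed.

Lemma groot_cactus n (G : rooted_graph 'rV[int]_n) : cactus G -> groot G = 0.
Proof. by elim=> // k {}G y _ /= -> _; exact: snoc0. Qed.

Lemma cactus_verts0 n (G : rooted_graph 'rV[int]_n) : cactus G -> gverts G 0.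
Proof.
elim=> // k {}G y _ V0 _; rewrite gverts_attach.
by left; exists 0; rewrite ?snoc0.
Qed.

Lemma extend_vertsP k (V : set 'rV[int]_k) y z :
  extend_verts V y z -> exists x t, z = snoc x t /\
  [\/ t = 0 /\ V x, t = 1 /\ x = 0 | t = -1 /\ x = y].
Proof.
move=> [[x Vx <-]|[|] ->].
- by exists x, 0; split => //; constructor 1.
- by exists 0, 1; split => //; constructor 2.
- by exists y, (-1); split => //; constructor 3.
Qed.

Lemma cactus_coord n (G : rooted_graph 'rV[int]_n) : cactus G ->
  forall v i, gverts G v -> `|v ord0 i| <= 1.
Proof.
elim=> [v [] //|k {}G y cG IH Gy v i].
rewrite gverts_attach => /extend_vertsP[x [t [-> H]]].
rewrite mxE; case: unliftP => [j _|_].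
  case: H => [[_]|[_ ->]|[_ ->]]; try exact: IH.
  by rewrite mxE.
by case: H => [[-> _]|[-> _]|[-> _]].
Qed.

(** An even coordinate of absolute value at most 1 is 0. *)
Lemma cactus_double n (G : rooted_graph 'rV[int]_n) : cactus G ->
  forall v a : 'rV[int]_n, gverts G v -> v = a + a -> a = 0.
Proof.
move=> cG v a Gv va; apply/rowP => j; rewrite mxE -[LHS]/(a ord0 j).
by have := cactus_coord cG j Gv; rewrite va mxE; move: (a _ _) => x; lia.
Qed.

(** Heights are compared. If [a] has height 1 or -1, so have [b] and [c], which then coincide. If
    [a] has height 0, either all three are old, or [b] and [c] are the two new vertices and [y] is
    twice an integral point, which must be 0. *)
Lemma cactus_midpoint n (G : rooted_graph 'rV[int]_n) : cactus G ->
  forall a b c, gverts G a -> gverts G b -> gverts G c ->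
    a + a = b + c -> b <> c -> a = 0.
Proof.
elim=> [? ? ? -> //|k {}G y cG IH Gy a b c].
rewrite gverts_attach.
move=> /extend_vertsP[xa [ta [-> Ha]]] /extend_vertsP[xb [tb [-> Hb]]].
move=> /extend_vertsP[xc [tc [-> Hc]]].
rewrite !snocD => /snoc_inj[E Et] bc.
case: Ha E Et => [] [? Ha] E Et; case: Hb E Et bc => [] [? Hb] E Et bc;
  case: Hc E Et bc => [] [? Hc] E Et bc; subst; try lia; try by case: bc.
- rewrite (IH xa xb xc) ?snoc0 // => bc'; by case: bc; rewrite bc'.
- by rewrite (@cactus_double _ _ cG y xa) ?snoc0 // E add0r.
- by rewrite (@cactus_double _ _ cG y xa) ?snoc0 // E addr0.
Qed.

(** A triangle with apex [a], expressed by addition alone so that linear maps can be tested on it;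
    the conditions on [b] and [c] discard the trivial relations a = a + 0. *)
Definition tri k (V : set 'rV[int]_k) (a b c : 'rV[int]_k) :=
  [/\ V a, V b /\ b <> 0, V c /\ c <> 0 & a = b + c].

Lemma triC k (V : set 'rV[int]_k) a b c : tri V a b c -> tri V a c b.
Proof. by move=> [Va Vb Vc E]; split=> //; rewrite addrC. Qed.

Lemma snoc_eq0 k (x : 'rV[int]_k) t : snoc x t = 0 <-> x = 0 /\ t = 0.
Proof.
split=> [|[-> ->]]; last exact: snoc0.
by rewrite -(snoc0 int k) => /snoc_inj.
Qed.

(** Heights add up. With [a] at height 0, the summands are both old or are the two new vertices.
    With [a] new, one summand equals [a] and the other would be 0. *)
Lemma tri_extend k (V : set 'rV[int]_k) y a b c : V y ->
  tri (extend_verts V y) a b c <->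
  (exists a' b' c', tri V a' b' c' /\
     [/\ a = snoc a' 0, b = snoc b' 0 & c = snoc c' 0]) \/
  (a = snoc y 0 /\ (b = snoc 0 1 /\ c = snoc y (-1) \/
                    b = snoc y (-1) /\ c = snoc 0 1)).
Proof.
move=> Vy; split; last first.
  have inl x : V x -> extend_verts V y (snoc x 0) by left; exists x.
  case=> [[a' [b' [c' [[Va [Vb b0] [Vc c0] E] [-> -> ->]]]]]|].
    split; first exact: inl.
    - by split; [exact: inl|move=> /snoc_eq0[]].
    - by split; [exact: inl|move=> /snoc_eq0[]].
    - by rewrite snocD E addr0.
  have e : extend_verts V y (snoc 0 1) /\ snoc (0 : 'rV[int]_k) 1 <> 0.
    by split; [right; left|move=> /snoc_eq0[_]].
  have f : extend_verts V y (snoc y (-1)) /\ snoc y (-1) <> 0.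
    by split; [right; right|move=> /snoc_eq0[_]].
  have E : snoc y 0 = snoc 0 1 + snoc y (-1) by rewrite snocD add0r subrr.
  by case=> -> [] [-> ->]; [|apply: triC]; split => //; exact: inl.
case=> /extend_vertsP[xa [ta [-> Ha]]] [/extend_vertsP[xb [tb [-> Hb]]] b0].
move=> [/extend_vertsP[xc [tc [-> Hc]]] c0].
rewrite snocD => /snoc_inj[E Et].
case: Ha E Et => [] [? Ha] E Et; case: Hb E Et b0 => [] [? Hb] E Et b0;
  case: Hc E Et c0 => [] [? Hc] E Et c0; subst; try lia.
- left; exists (xb + xc), xb, xc; split => //; split => //; split => //.
    by move=> H; apply: b0; rewrite H snoc0.
  by move=> H; apply: c0; rewrite H snoc0.
- by right; rewrite add0r; split => //; left.
- by right; rewrite addr0; split => //; right.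
- by case: b0; rewrite addr0 in E; rewrite -E snoc0.
- by case: c0; rewrite add0r in E; rewrite -E snoc0.
- by case: b0; rewrite -[y in LHS]add0r in E; move/addIr: E => <-; rewrite snoc0.
- by case: c0; rewrite -[y in LHS]addr0 in E; move/addrI: E => <-; rewrite snoc0.
Qed.

(** A nonzero vertex lies below only one apex: a new vertex lies below [y] alone, and the new
    triangle has no old vertex below its apex. *)
Lemma tri_uniq n (G : rooted_graph 'rV[int]_n) : cactus G ->
  forall a b c a' c', tri (gverts G) a b c -> tri (gverts G) a' b c' ->
    a = a' /\ c = c'.
Proof.
elim=> [a b c a' c' [_ [->]] //|k {}G y cG IH Gy a b c a' c'].
rewrite gverts_attach => /(tri_extend _ _ _ Gy) + /(tri_extend _ _ _ Gy).
case=> [[xa [xb [xc [T [-> -> ->]]]]]|[-> [[-> ->]|[-> ->]]]];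
  case=> [[xa' [xb' [xc' [T' [-> E ->]]]]]|[-> [[E ->]|[E ->]]]] //;
  case/snoc_inj: E => E1 E2 //.
by subst xb'; have [-> ->] := IH _ _ _ _ _ T T'.
Qed.

(** Induction from the root down the tree of triangles: each new vertex lies below the old vertex at
    which its triangle was attached. *)
Lemma cactus_rect n (G : rooted_graph 'rV[int]_n) : cactus G ->
  forall Q : 'rV[int]_n -> Prop, Q 0 ->
    (forall a b c, tri (gverts G) a b c -> Q a -> Q b) ->
  forall v, gverts G v -> Q v.
Proof.
elim=> [Q Q0 _ v -> //|k {}G y cG IH Gy Q Q0 QT v].
rewrite gverts_attach in QT *.
have Q' x : gverts G x -> Q (snoc x 0).
  apply: (IH (fun x => Q (snoc x 0))); first by rewrite snoc0.
  move=> a b c T; apply: (QT _ _ (snoc c 0)).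
  by apply/(tri_extend _ _ _ Gy); left; exists a, b, c.
move=> [[x Gx <-]|[|] ->]; first exact: Q'.
- apply: (QT (snoc y 0) _ (snoc y (-1))); last exact: Q'.
  by apply/(tri_extend _ _ _ Gy); right; split => //; left.
- apply: (QT (snoc y 0) _ (snoc 0 1)); last exact: Q'.
  by apply/(tri_extend _ _ _ Gy); right; split => //; right.
Qed.

Lemma gadjE n (G : rooted_graph 'rV[int]_n) : cactus G -> forall u v,
  gadj G u v <-> exists a b c, tri (gverts G) a b c /\ triangle_adj a b c u v.
Proof.
elim=> [u v|k {}G y cG IH Gy u v].
  by split => // -[a [b [c [[_ [->]]]]]].
rewrite gverts_attach /= snocB_e; split.
  case=> [[x [x' [/IH[a [b [c [T [n1 n2 n3]]]]] -> ->]]]|A].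
    exists (snoc a 0), (snoc b 0), (snoc c 0); split.
      by apply/(tri_extend _ _ _ Gy); left; exists a, b, c.
    split; first by move=> /snoc_inj[].
    - by case: n2 => [[]|] ->; [left; left|left; right|right].
    - by case: n3 => [[]|] ->; [left; left|left; right|right].
  exists (snoc y 0), (snoc 0 1), (snoc y (-1)); split => //.
  by apply/(tri_extend _ _ _ Gy); right; split => //; left.
case=> a [b [c [/(tri_extend _ _ _ Gy)]]].
case=> [[a' [b' [c' [T [-> -> ->]]]]]|[-> [[-> ->]|[-> ->]]]] [n1 n2 n3].
- left.
  have [x n2' ux] : exists2 x, [set a'; b'; c'] x & u = snoc x 0.
    by case: n2 => [[]|] ->; [exists a'|exists b'|exists c'] => //;
      [left; left|left; right|right].
  have [x' n3' vx] : exists2 x, [set a'; b'; c'] x & v = snoc x 0.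
    by case: n3 => [[]|] ->; [exists a'|exists b'|exists c'] => //;
      [left; left|left; right|right].
  exists x, x'; split => //; apply/IH; exists a', b', c'; split => //.
  by split => // E; apply: n1; rewrite ux vx E.
- by right.
- by right; split => //; rewrite -setUA (setUC [set snoc 0 1]) setUA.
Qed.

(** What needs proof is that the vertices are distinct: a = b would give c = 0, and b = c would make
    [a] twice [b], hence b = 0. *)
Lemma tri_gadj n (G : rooted_graph 'rV[int]_n) : cactus G -> forall a b c,
  tri (gverts G) a b c -> [/\ gadj G a b, gadj G b c & gadj G a c].
Proof.
move=> cG a b c T; have [_ [_ b0] [_ c0] E] := T.
have inT u v : u <> v -> [set a; b; c] u -> [set a; b; c] v -> gadj G u v.
  by move=> *; apply/(gadjE cG); exists a, b, c.
have Ta : [set a; b; c] a by left; left.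
have Tb : [set a; b; c] b by left; right.
have Tc : [set a; b; c] c by right.
split; apply: inT => //.
- by rewrite E -[X in _ <> X]addr0 => /addrI.
- move=> bc; apply: b0; have [Ga _ _ _] := T.
  by apply: (cactus_double cG Ga); rewrite E bc.
- by rewrite E -[X in _ <> X]add0r => /addIr.
Qed.

(** The new triangle meets the old graph in one vertex only. So two old edges of a clique force the
    third to be old, and two new edges place all three vertices in the new triangle. *)
Lemma clique_tri n (G : rooted_graph 'rV[int]_n) : cactus G -> forall u v w,
  gadj G u v -> gadj G v w -> gadj G u w ->
  [\/ tri (gverts G) u v w, tri (gverts G) v u w | tri (gverts G) w u v].
Proof.
elim=> // k {}G y cG IH Gy u v w.
rewrite gverts_attach /= snocB_e.
set V' := extend_verts (gverts G) y.
have T1 : tri V' (snoc y 0) (snoc 0 1) (snoc y (-1)).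
  by apply/(tri_extend _ _ _ Gy); right; split => //; left.
have T2 := triC T1.
have old u' v' w' : tri (gverts G) u' v' w' ->
    tri V' (snoc u' 0) (snoc v' 0) (snoc w' 0).
  by move=> T; apply/(tri_extend _ _ _ Gy); left; exists u', v', w'.
pose new := [set snoc y 0; snoc 0 1; snoc y (-1)].
have inside u' v' w' : new u' -> new v' -> new w' ->
    u' <> v' -> v' <> w' -> u' <> w' ->
    [\/ tri V' u' v' w', tri V' v' u' w' | tri V' w' u' v'].
  move=> [[]|] -> [[]|] -> [[]|] -> uv vw uw;
    by [case: uv|case: vw|case: uw|constructor 1|constructor 2|constructor 3].
have outside (x x' : 'rV[int]_k) :
    ~ triangle_adj (snoc y 0) (snoc 0 1) (snoc y (-1)) (snoc x 0) (snoc x' 0).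
  have E t : new (snoc t 0) -> t = y by move=> [[]|] /snoc_inj[].
  by case=> xx' /E xE /E x'E; apply: xx'; rewrite xE x'E.
have neq (u' v' : 'rV[int]_k.+1) x x' :
    gadj G x x' -> u' = snoc x 0 -> v' = snoc x' 0 -> u' <> v'.
  by move=> /(gadjE cG)[a [b [c [_ [xx' _ _]]]]] -> -> /snoc_inj[].
move=> [[x [x' [A1 E1 E1']]]|A1] [[z [z' [A2 E2 E2']]]|A2] [[t [t' [A3 E3 E3']]]|A3].
- have [? ?] : z = x' /\ t = x.
    by case/snoc_inj: (etrans (esym E1') E2); case/snoc_inj: (etrans (esym E1) E3).
  have ? : t' = z' by case/snoc_inj: (etrans (esym E2') E3').
  subst z t t'; rewrite E1 E1' E2'.
  by case: (IH _ _ _ A1 A2 A3) => /old T; [constructor 1|constructor 2|constructor 3].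
- by case: (outside x z'); rewrite -E1 -E2'.
- by case: (outside x' t'); rewrite -E1' -E3'.
- case: A2 A3 => vw vT wT [uw uT _].
  exact: (inside _ _ _ uT vT wT (neq _ _ _ _ A1 E1 E1') vw uw).
- by case: (outside t z); rewrite -E3 -E2.
- case: A1 A3 => uv uT vT [uw _ wT].
  exact: (inside _ _ _ uT vT wT uv (neq _ _ _ _ A2 E2 E2') uw).
- case: A1 A2 => uv uT vT [vw _ wT].
  exact: (inside _ _ _ uT vT wT uv vw (neq _ _ _ _ A3 E3 E3')).
- by case: A1 A2 A3 => uv uT vT [vw _ wT] [uw _ _]; exact: inside uT vT wT _ _ _.
Qed.

(** * Linear extension of maps given on the vertices *)

Lemma cactus_basis n (G : rooted_graph 'rV[int]_n) : cactus G ->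
  forall i, gverts G (delta_mx ord0 i).
Proof.
elim=> [[]//|k {}G y cG IH Gy i].
rewrite gverts_attach; case: (unliftP ord_max i) => [j|] ->.
  left; exists (delta_mx ord0 j) => //; apply/rowP => l; rewrite !mxE.
  case: unliftP => [l'|] ->; first by rewrite mxE (inj_eq lift_inj).
  by rewrite (negbTE (neq_lift _ _)) andbF.
right; left; apply/rowP => l; rewrite !mxE.
case: unliftP => [l'|] ->; last by rewrite eqxx.
by rewrite mxE [lift _ _ == _]eq_sym (negbTE (neq_lift _ _)) andbF.
Qed.

(** Each step of the construction adds one row to the matrix, the image of the new basis vector e;
    the value at y - e is then forced by the relation of the new triangle. *)
Lemma tri_linear n (G : rooted_graph 'rV[int]_n) : cactus G ->
  forall m (g : 'rV[int]_n -> 'rV[int]_m), g 0 = 0 ->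
    (forall a b c, tri (gverts G) a b c -> g a = g b + g c) ->
  exists U : 'M_(n, m), forall v, gverts G v -> g v = v *m U.
Proof.
elim=> [m g g0 _|k {}G y cG IH Gy m g g0 gT].
  by exists 0 => v ->; rewrite mulmx0.
rewrite gverts_attach in gT *.
have [|a b c T|U gU] := IH m (fun x => g (snoc x 0)).
- by rewrite snoc0.
- by apply: gT; apply/(tri_extend _ _ _ Gy); left; exists a, b, c.
exists (\matrix_(i, j) (if unlift ord_max i is Some l then U l j
                        else g (snoc 0 1) ord0 j)).
move=> v [[x Gx <-]|[|] ->]; rewrite snoc_mulmx.
- by rewrite scale0r addr0 gU.
- by rewrite mul0mx add0r scale1r.
- rewrite scaleN1r -gU //; apply: (addIr (g (snoc 0 1))); rewrite subrK.
  rewrite -(gT (snoc y 0)) //; apply/(tri_extend _ _ _ Gy).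
  by right; split => //; right.
Qed.

(** * Isomorphisms of rooted cacti send apexes to apexes *)

Section IsoTriangles.
Variables (n : nat) (G H : rooted_graph 'rV[int]_n).
Variable (f : 'rV[int]_n -> 'rV[int]_n).
Hypotheses (cG : cactus G) (cH : cactus H).
Hypothesis f_bij : set_bij (gverts G) (gverts H) f.
Hypothesis f0 : f 0 = 0.
Hypothesis fE : forall u v, gverts G u -> gverts G v ->
  (gadj G u v <-> gadj H (f u) (f v)).

(* Induction from the root: if v <> 0 is the apex of a triangle, then v lies
   below the apex u of another triangle, which is mapped correctly, so f v lies
   below f u.  As f v lies below a single apex, it is the apex of the image of
   the first triangle. *)
Lemma iso_tri a b c : tri (gverts G) a b c -> tri (gverts H) (f a) (f b) (f c).
Proof.
have [fV finj _] := f_bij.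
have inj u v : gverts G u -> gverts G v -> f u = f v -> u = v.
  by move=> Gu Gv; apply: finj; rewrite inE.
have clique u v w : tri (gverts G) u v w -> [\/ tri (gverts H) (f u) (f v) (f w),
    tri (gverts H) (f v) (f u) (f w) | tri (gverts H) (f w) (f u) (f v)].
  move=> T; have [Gu [Gv _] [Gw _] _] := T.
  by have [/fE uv /fE vw /fE uw] := tri_gadj cG T; apply: (clique_tri cH); auto.
suff Q : forall v, gverts G v -> forall b' c', tri (gverts G) v b' c' ->
    tri (gverts H) (f v) (f b') (f c').
  by move=> T; have [Ga _ _ _] := T; exact: Q.
(* At the root, the other two orientations would put [f 0], which is 0, below an apex. *)
apply: (cactus_rect cG) => [b' c' T|u v w T Q d e T'].
  by case: (clique _ _ _ T) => //; rewrite f0 => -[_ [_ []]].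
have fT := triC (Q _ _ T); have {}Q := Q _ _ T.
have [Gu [Gv _] [Gw w0] uE] := T; have [_ [Gd _] [Ge _] vE] := T'.
(* If [f v] were below [f d'], uniqueness of its triangle would give u = d' and w = e'. Then v = u +
   w together with u = v + w yields w + w = 0, hence w = 0. *)
have cycle d' e' : gverts G d' -> gverts G e' -> v = d' + e' ->
    ~ tri (gverts H) (f d') (f v) (f e').
  move=> Gd' Ge' v'E fT'; have [fud fwe] := tri_uniq cH Q fT'.
  have ud := inj _ _ Gu Gd' fud; have we := inj _ _ Gw Ge' fwe.
  apply: w0; apply: (cactus_double cG (cactus_verts0 cG)).
  apply: (addrI v); rewrite addr0 addrA -uE [LHS]v'E ud we //.
case: (clique _ _ _ T') => [//|/(cycle _ _ Gd Ge vE)//|fT'].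
by case: (cycle e d) => //; rewrite addrC.
Qed.

End IsoTriangles.

(** * Unimodular equivalence *)

Section RealPolytopes.
Variable R : realType.

Lemma to_realM k m (x : 'rV[int]_k) (U : 'M[int]_(k, m)) :
  to_real R (x *m U) = to_real R x *m map_mx intr U.
Proof. exact: map_mxM. Qed.

Lemma to_realD k (x y : 'rV[int]_k) :
  to_real R (x + y) = to_real R x + to_real R y.
Proof. exact: map_mxD. Qed.

Lemma map_intr_mulV k (U V : 'M[int]_k) : U *m V = 1%:M ->
  map_mx intr U *m map_mx intr V = 1%:M :> 'M[R]_k.
Proof. by move=> UV; rewrite -map_mxM UV map_mx1. Qed.

Lemma unimod_equiv_sym k (P Q : set 'rV[R]_k) :
  unimod_equiv P Q -> unimod_equiv Q P.
Proof.
move=> [U [t [Uu ->]]]; exists (invmx U), (- t *m invmx U).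
rewrite unitmx_inv; split => //; apply/seteqP; split.
  move=> x Px; exists (x *m map_mx intr U + to_real R t); first by exists x.
  rewrite to_realM -mulmxDl -addrA -to_realD subrr to_real0 addr0.
  by rewrite -mulmxA map_intr_mulV ?mulmxV ?mulmx1.
move=> _ [_ [x Px <-] <-].
rewrite to_realM -mulmxDl -addrA -to_realD subrr to_real0 addr0.
by rewrite -mulmxA map_intr_mulV ?mulmxV ?mulmx1.
Qed.

Lemma unimod_equiv_trans k (P Q S : set 'rV[R]_k) :
  unimod_equiv P Q -> unimod_equiv Q S -> unimod_equiv P S.
Proof.
move=> [U [t [Uu ->]]] [V [s [Vu ->]]]; exists (U *m V), (t *m V + s).
rewrite unitmx_mul Uu Vu; split => //.
have E x : x *m map_mx intr (U *m V) + to_real R (t *m V + s) =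
    (x *m map_mx intr U + to_real R t) *m map_mx intr V + to_real R s.
  by rewrite map_mxM to_realD to_realM mulmxDl mulmxA addrA.
apply/seteqP; split => [_ [_ [x Px <-] <-]|_ [x Px <-]].
  by exists x.
by rewrite E; exists (x *m map_mx intr U + to_real R t) => //; exists x.
Qed.

Lemma conv_points : conv [set to_real R x | x in [set (0 : 'rV[int]_0)]] = setT.
Proof.
apply/seteqP; split => // x _; apply: sub_conv; exists 0 => //.
by apply/rowP => -[].
Qed.

(** The invariants of one construction step, for any base that has them; this covers the step from
    the point in dimension 0 to the segment as well. *)
Lemma Pbipyr_cactus k (P : set 'rV[R]_k) (G : rooted_graph 'rV[int]_k) y :
  cactus G -> P = conv [set to_real R x | x in gverts G] ->
  lattice_points P = gverts G -> lattice_points P y ->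
  [/\ cactus (attach_triangle G y),
      Pbipyr P 0 y = conv [set to_real R x | x in gverts (attach_triangle G y)] &
      lattice_points (Pbipyr P 0 y) = gverts (attach_triangle G y)].
Proof.
move=> cG PE LP Py; rewrite gverts_attach; split.
- by apply: cactusS => //; rewrite -LP.
- by rewrite PE Pbipyr_conv.
- rewrite lattice_points_Pbipyr ?LP //; first by rewrite PE; exact: convex_conv.
    by have := cactus_verts0 cG; rewrite -LP /lattice_points /= to_real0.
  by rewrite -LP.
Qed.

Lemma segment_Pbipyr :
  [set x : 'rV[R]_1 | -1 <= x ord0 ord0 <= 1] = Pbipyr setT 0 0.
Proof.
have mx1 (a : R) : (snoc 0 a : 'rV[R]_1) ord0 ord0 = a.
  by rewrite mxE; case: unliftP => // -[].
apply/seteqP; split=> [x /andP[x0 x1]|].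
  (* A number x in the segment is the combination of 1 and -1 with weights (1 + x)/2 and (1 -
     x)/2. *)
  rewrite (_ : x = ((1 + x ord0 ord0) / 2) *: snoc (to_real R 0) 1 +
                  ((1 - x ord0 ord0) / 2) *: snoc (to_real R 0) (-1)).
    have cP : convex (Pbipyr [set: 'rV[R]_0] 0 0) by exact: convex_conv.
    apply: (convexE cP); try lra.
    - by apply: sub_conv; left; left.
    - by apply: sub_conv; left; right.
  apply/rowP => j; rewrite (ord1 j) to_real0 !snocZ snocD !scaler0 addr0 mx1.
  by rewrite -[LHS]/(x ord0 ord0); lra.
apply: conv_min => [t x y /andP[t0 t1] /andP[x0 x1] /andP[y0 y1] /=|].
  rewrite !mxE; apply/andP; split; nra.
have z0 : (0 : 'rV[R]_0) = to_real R 0 by rewrite to_real0.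
move=> _ [[|]->|[x _ <-]] /=; first 2 last.
- by rewrite (_ : x = 0) ?mx1 ?lerN10 ?ler01 //; apply/rowP => -[].
- by rewrite -z0 mx1 lexx andbT; lra.
- by rewrite -z0 mx1 lexx /=; lra.
Qed.

Lemma construction_cactus n (P : set 'rV[R]_n) G : construction P G ->
  [/\ cactus G, P = conv [set to_real R x | x in gverts G] &
      lattice_points P = gverts G].
Proof.
elim=> [|k {}P {}G y _ [cG PE LP] Py]; last exact: Pbipyr_cactus.
have L0 : lattice_points [set: 'rV[R]_0] = [set 0].
  by apply/seteqP; split => // x _; apply/rowP => -[].
pose G0 := {|
  gverts := [set (0 : 'rV[int]_0)]; gadj := fun _ _ => False; groot := 0 |}.
have GE : cactus1 = attach_triangle G0 0.
  have e1 : snoc (0 : 'rV[int]_0) 1 = const_mx 1.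
    by apply/rowP => j; rewrite !mxE; case: unliftP => // -[].
  have eN1 : snoc (0 : 'rV[int]_0) (-1) = const_mx (-1).
    by apply/rowP => j; rewrite !mxE; case: unliftP => // -[].
  rewrite /attach_triangle /= snocB_e snoc0 e1 eN1 /cactus1; congr RootedGraph.
    by rewrite image_set1 snoc0 setUA.
  apply/funext => u; apply/funext => v; apply/propext.
  by split=> [?|[[x [x' [[]]]]|//]]; right.
rewrite GE segment_Pbipyr.
by apply: Pbipyr_cactus cactus0 _ L0 _; rewrite ?conv_points.
Qed.

End RealPolytopes.

(** The first triangle hangs at the root, the only vertex in dimension 0, and later steps keep it.
    It exhibits the origin as a midpoint, which serves to exclude translations. *)
Lemma cactus_root_tri n (G : rooted_graph 'rV[int]_n) : cactus G ->
  (0 < n)%N -> exists b c, tri (gverts G) 0 b c.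
Proof.
elim=> // -[|k] {}G y cG IH Gy _; rewrite gverts_attach.
  exists (snoc 0 1), (snoc y (-1)); apply/(tri_extend _ _ _ Gy); right.
  by split; [apply/rowP => j; rewrite !mxE; case: unliftP => // -[]|left].
have [//|b [c T]] := IH; exists (snoc b 0), (snoc c 0).
by apply/(tri_extend _ _ _ Gy); left; exists 0, b, c; rewrite snoc0.
Qed.

(** * From unimodular maps to isomorphisms and back *)

Lemma triangle_adj_inj (S T : Type) (f : S -> T) a b c u v : injective f ->
  triangle_adj a b c u v <-> triangle_adj (f a) (f b) (f c) (f u) (f v).
Proof.
move=> fI.
have memf x : [set a; b; c] x <-> [set f a; f b; f c] (f x).
  split; first by case=> [[]|] ->; [left; left|left; right|right].
  by case=> [[]|] /fI ->; [left; left|left; right|right].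
split=> -[uv Tu Tv]; split; try exact/memf.
  by move=> /fI.
by move=> E; apply: uv; rewrite E.
Qed.

Lemma tri_mulmx n (V : set 'rV[int]_n) (U : 'M[int]_n) a b c : U \in unitmx ->
  V a -> V b -> V c ->
  tri V a b c <-> tri [set x *m U | x in V] (a *m U) (b *m U) (c *m U).
Proof.
move=> Uu Va Vb Vc; have UI := can_inj (@mulmxK _ n 1 U Uu).
split=> -[_ [_ b0] [_ c0] E]; split.
- by exists a.
- by split=> [|bU]; [exists b|apply: b0; apply: UI; rewrite bU mul0mx].
- by split=> [|cU]; [exists c|apply: c0; apply: UI; rewrite cU mul0mx].
- by rewrite E mulmxDl.
- by [].
- by split => // bE; apply: b0; rewrite bE mul0mx.
- by split => // cE; apply: c0; rewrite cE mul0mx.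
- by apply: UI; rewrite mulmxDl.
Qed.

Lemma unimod_iso n (R : realType) (P1 P2 : set 'rV[R]_n) G1 G2 :
  cactus G1 -> cactus G2 ->
  lattice_points P1 = gverts G1 -> lattice_points P2 = gverts G2 ->
  (0 < n)%N -> unimod_equiv P1 P2 -> rooted_iso G1 G2.
Proof.
move=> c1 c2 L1 L2 n0 [U [t [Uu PE]]].
have UI := can_inj (@mulmxK _ n 1 U Uu).
have VE : gverts G2 = [set x *m U + t | x in gverts G1].
  rewrite -L1 -L2 PE; apply/seteqP; split=> [w [x Px xE]|_ [x Px <-]].
    (* As [U] is invertible over the integers, the preimage of a lattice point is a lattice
       point. *)
    have wE : (w - t) *m invmx U *m U + t = w by rewrite mulmxKV // subrK.
    exists ((w - t) *m invmx U) => //; rewrite /lattice_points /=.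
    suff -> : to_real R ((w - t) *m invmx U) = x by [].
    have UrI : injective (fun z : 'rV[R]_n => z *m map_mx intr U).
      apply: (can_inj (g := fun z => z *m map_mx intr (invmx U))) => z.
      by rewrite -mulmxA map_intr_mulV ?mulmxV ?mulmx1.
    apply: UrI; apply: (addIr (to_real R t)).
    by rewrite -to_realM -to_realD wE.
  by exists (to_real R x) => //; rewrite to_realD to_realM.
(* A root triangle gives 0 = b + c, so [t], the image of the origin, is the midpoint of the images
   of [b] and [c]; these differ, so t = 0. *)
have t0 : t = 0.
  have G2f x : gverts G1 x -> gverts G2 (x *m U + t) by rewrite VE; exists x.
  have [b [c [G10 [Gb b0] [Gc _] bc0]]] := cactus_root_tri c1 n0.
  apply: (cactus_midpoint c2) (G2f b Gb) (G2f c Gc) _ _.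
  - by have := G2f 0 G10; rewrite mul0mx add0r.
  - by rewrite addrACA -mulmxDl -bc0 mul0mx add0r.
  - move=> /addIr/UI bc; apply: b0; apply: (cactus_double c1 G10).
    by rewrite {2}bc.
have {}VE : gverts G2 = [set x *m U | x in gverts G1].
  by rewrite VE t0; apply: eq_imagel => x _; rewrite addr0.
exists (fun x => x *m U); split.
- split=> [x Gx /=|x y _ _ /UI //|]; first by rewrite VE; exists x.
  by rewrite VE.
- by rewrite !groot_cactus // mul0mx.
move=> u v Gu Gv; split.
  move=> /(gadjE c1)[a [b [c [T A]]]]; have [Ga [Gb _] [Gc _] _] := T.
  apply/(gadjE c2); exists (a *m U), (b *m U), (c *m U).
  rewrite VE -tri_mulmx //; split => //.
  exact: (proj1 (triangle_adj_inj _ _ _ _ _ UI) A).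
move=> /(gadjE c2)[a' [b' [c' [T A]]]].
rewrite VE in T; have [[a Ga aE] [[b Gb bE] _] [[c Gc cE] _] _] := T.
subst a' b' c'; apply/(gadjE c1); exists a, b, c; split.
  by move: T; rewrite -tri_mulmx.
exact: (proj2 (triangle_adj_inj _ _ _ _ _ UI) A).
Qed.

Lemma iso_unimod n (R : realType) (G1 G2 : rooted_graph 'rV[int]_n) :
  cactus G1 -> cactus G2 -> rooted_iso G1 G2 ->
  unimod_equiv (conv [set to_real R x | x in gverts G1])
               (conv [set to_real R x | x in gverts G2]).
Proof.
move=> cG cH [f [fb f0 fE]].
rewrite !groot_cactus // in f0.
have fT := iso_tri cG cH fb f0 fE.
have [U fU] : exists U : 'M_n, forall v, gverts G1 v -> f v = v *m U.
  by apply: (tri_linear cG) => // a b c /fT[].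
have [fV finj fsurj] := fb.
have VE : gverts G2 = [set x *m U | x in gverts G1].
  apply/seteqP; split.
    by move=> _ /fsurj[x Gx <-]; exists x => //; rewrite fU.
  by move=> _ [x Gx <-]; rewrite -fU //; exact: fV.
(* The basis vectors are vertices of [G2], hence images of integral vectors; the latter are the rows
   of an integral left inverse of [U]. *)
have lift_basis i : exists x : 'rV_n, x *m U = delta_mx ord0 i.
  by have := cactus_basis cH i; rewrite VE => -[x _ xE]; exists x.
have [w wE] := choice lift_basis.
have WU : (\matrix_i w i) *m U = 1%:M.
  by apply/row_matrixP => i; rewrite row_mul rowK wE row1.
have [_ Uu] := mulmx1_unit WU.
exists U, 0; split => //.
rewrite VE to_real0.
under [in RHS]eq_imagel do rewrite addr0.
rewrite -conv_linear; congr conv.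
by rewrite !image_comp; apply: eq_imagel => x _ /=; rewrite to_realM.
Qed.

Theorem theorem9p5 (R : realType) (n : nat) (hn : (1 <= n)%N)
    (P1 P2 : set 'rV[R]_n) (G1 G2 : rooted_graph 'rV[int]_n)
    (hP1 : in_C_with_cactus P1 G1) (hP2 : in_C_with_cactus P2 G2) :
  unimod_equiv P1 P2 <-> rooted_iso G1 G2.
Proof.
(* Both polytopes are replaced by constructed representatives, whose lattice points are the cactus
   vertices themselves. *)
have [Q1 /construction_cactus[c1 E1 L1] Q1P] := hP1.
have [Q2 /construction_cactus[c2 E2 L2] Q2P] := hP2.
split=> [P12|iso].
  apply: (unimod_iso c1 c2 L1 L2 hn).
  exact: unimod_equiv_trans Q1P (unimod_equiv_trans P12 (unimod_equiv_sym Q2P)).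
apply: unimod_equiv_trans (unimod_equiv_sym Q1P) (unimod_equiv_trans _ Q2P).
by rewrite E1 E2; exact: iso_unimod.
Qed.
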